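(* (Limit-Free Formula) Let $M_\phi\in\mathrm{Mod}(R[X])$. Then $$\widetilde{\mathrm{ent}}_v(M_\phi)=\sup\{L_v(N/\phi^{-1}N) : N\le M \text{ is a } \phi\text{-inert } R\text{-submodule and } \phi^{-1}N\subseteq N\}.$$
   Context: $R$ is a non-discrete archimedean valuation domain: a valuation domain with field of fractions $Q$ and valuation $v\colon Q\to\Gamma(R)\cup\{\infty\}$ whose value group $\Gamma(R)$ is a dense subgroup of the ordered additive group $\mathbb R$. Put $\mathbb R^*=\mathbb R_{\ge 0}\cup\{\infty\}$. A length function on $\mathrm{Mod}(R)$ is a function $L\colon\mathrm{Mod}(R)\to\mathbb R^*$ with $L(0)=0$, invariant under isomorphism, additive on short exact sequences, and with $L(M)=\sup\{L(F):F\le M\text{ finitely generated}\}$. $L_v$ denotes the (unique) length function on $\mathrm{Mod}(R)$ with $L_v(R/I)=\inf_{r\in I}v(r)$ for every ideal $I$ of $R$ (Northcott–Reufel). For an $R$-module $M$ and $\phi\in\mathrm{End}_R(M)$, $M_\phi$ denotes the $R[X]$-module $M$ on which $X$ acts as $\phi$. For an $R$-submodule $K\le M$ and $n\ge1$, $T_n(\phi,K)=K+\phi K+\dots+\phi^{n-1}K$, and $\phi^{-1}K$ is the preimage of $K$ under $\phi$. An $R$-submodule $H\le M$ is $\phi$-inert if $L_v((H+\phi H)/H)<\infty$; $\mathcal I_\phi(M)$ is the set of $\phi$-inert submodules of $M$. For $H\in\mathcal I_\phi(M)$, $\widetilde{\mathrm{ent}}_v(\phi,H)=\lim_{n\to\infty}\frac{L_v(T_n(\phi,H)/H)}{n}$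 (the limit exists and is finite), and $\widetilde{\mathrm{ent}}_v(M_\phi)=\sup_{H\in\mathcal I_\phi(M)}\widetilde{\mathrm{ent}}_v(\phi,H)$. *)

(* Defs.v *)
From HB Require Import structures.
From mathcomp Require Import all_boot all_order all_algebra.
From mathcomp Require Import all_classical all_reals all_analysis.

Set Implicit Arguments.
Unset Strict Implicit.
Unset Printing Implicit Defensive.

Import Order.TTheory GRing.Theory Num.Theory.
Import numFieldNormedType.Exports.

Local Open Scope classical_set_scope.
Local Open Scope ring_scope.
Local Open Scope quotient_scope.

(* Submodules of M are the terms of type [submodClosed M]; since membership is
   decidable classically, these are all the submodules. *)

Section ZeroSubmodule.
Variables (R : pzRingType) (V : lmodType R).

Definition zerosm_pred : {pred V} := [pred x | x == 0].

Fact zerosm_closed : submod_closed zerosm_pred.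
Proof.
split=> [|a x y]; first by rewrite inE.
by rewrite !inE => /eqP-> /eqP->; rewrite scaler0 addr0.
Qed.

HB.instance Definition _ := GRing.isSubmodClosed.Build R V zerosm_pred
  zerosm_closed.

Definition zerosm : submodClosed V := zerosm_pred.

End ZeroSubmodule.

Arguments zerosm {R} V.

Section SumSubmodule.
Variables (R : pzRingType) (V : lmodType R) (A B : submodClosed V).

Definition addsm_pred : {pred V} :=
  [pred x | `[< exists a b, [/\ a \in A, b \in B & x = a + b] >]].

Fact addsm_closed : submod_closed addsm_pred.
Proof.
split=> [|c x y].
  by apply/asboolP; exists 0, 0; split; rewrite ?rpred0 ?addr0.
move=> /asboolP[a [b [aA bB ->]]] /asboolP[a' [b' [aA' bB' ->]]].
apply/asboolP; exists (c *: a + a'), (c *: b + b').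
by split; rewrite ?rpredD ?rpredZ // scalerDr addrACA.
Qed.

HB.instance Definition _ := GRing.isSubmodClosed.Build R V addsm_pred
  addsm_closed.

Definition addsm : submodClosed V := addsm_pred.

End SumSubmodule.

Section ImageSubmodule.
Variables (R : pzRingType) (V W : lmodType R) (f : {linear V -> W}).
Variable A : submodClosed V.

Definition imsm_pred : {pred W} :=
  [pred y | `[< exists2 x, x \in A & y = f x >]].

Fact imsm_closed : submod_closed imsm_pred.
Proof.
split=> [|c x y].
  by apply/asboolP; exists 0; rewrite ?rpred0 ?linear0.
move=> /asboolP[a aA ->] /asboolP[b bA ->]; apply/asboolP.
by exists (c *: a + b); rewrite ?rpredD ?rpredZ // linearP.
Qed.

HB.instance Definition _ := GRing.isSubmodClosed.Build R W imsm_pred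
  imsm_closed.

Definition imsm : submodClosed W := imsm_pred.

End ImageSubmodule.

Section PreimageSubmodule.
Variables (R : pzRingType) (V W : lmodType R) (f : {linear V -> W}).
Variable A : submodClosed W.

Definition preimsm_pred : {pred V} := [pred x | f x \in A].

Fact preimsm_closed : submod_closed preimsm_pred.
Proof.
split=> [|c x y]; first by rewrite inE linear0 rpred0.
by rewrite !inE => xA yA; rewrite linearP rpredD ?rpredZ.
Qed.

HB.instance Definition _ := GRing.isSubmodClosed.Build R V preimsm_pred
  preimsm_closed.

Definition preimsm : submodClosed V := preimsm_pred.

End PreimageSubmodule.

Section SubmoduleType.
Variables (R : pzRingType) (V : lmodType R) (A : submodClosed V).

Definition submodule : Type := {x : V | x \in A}.

HB.instance Definition _ := SubChoice.on submodule.
HB.instance Definition _ := [SubChoice_isSubLmodule of submodule by <:].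

Definition submodule_val : {linear submodule -> V} := val : submodule -> V.

End SubmoduleType.

Section QuotientModule.
Variables (R : pzRingType) (V : lmodType R) (A : submodClosed V).

(* [submodClosed] does not inherit from [zmodClosed], which the library's
   quotient requires. *)
Definition submod_pred : {pred V} := fun x => x \in A.

HB.instance Definition _ := GRing.isSubmodClosed.Build R V submod_pred
  (submodClosedP A).

Definition quotmod : Type := Quotient.quot (submod_pred : zmodClosed V).

HB.instance Definition _ := GRing.Zmodule.on quotmod.

Definition quotmod_pi (x : V) : quotmod :=
  \pi_(Quotient.quot (submod_pred : zmodClosed V)) x.

Definition quotmod_repr (x : quotmod) : V := repr x.

Lemma quotmod_reprK : cancel quotmod_repr quotmod_pi.
Proof. exact: reprK. Qed.

Lemma quotmod_piE x y : quotmod_pi x = quotmod_pi y <-> x - y \in A.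
Proof.
rewrite -[_ \in A]/(x - y \in (submod_pred : zmodClosed V)).
by rewrite Quotient.idealrBE; split=> /eqP.
Qed.

Lemma quotmod_piD x y : quotmod_pi (x + y) = quotmod_pi x + quotmod_pi y.
Proof. by rewrite /quotmod_pi !piE. Qed.

Definition quotmod_scale (a : R) (x : quotmod) : quotmod :=
  quotmod_pi (a *: quotmod_repr x).

Lemma quotmod_piZ a x : quotmod_pi (a *: x) = quotmod_scale a (quotmod_pi x).
Proof.
apply/quotmod_piE; rewrite -scalerBr; apply: rpredZ.
by apply/quotmod_piE; rewrite quotmod_reprK.
Qed.

Fact quotmod_scaleA a b x :
  quotmod_scale a (quotmod_scale b x) = quotmod_scale (a * b) x.
Proof. by rewrite -[x]quotmod_reprK -!quotmod_piZ scalerA. Qed.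

Fact quotmod_scale1 : left_id 1 quotmod_scale.
Proof. by move=> x; rewrite -[x]quotmod_reprK -!quotmod_piZ scale1r. Qed.

Fact quotmod_scaleDr : right_distributive quotmod_scale +%R.
Proof.
move=> a x y; rewrite -[x]quotmod_reprK -[y]quotmod_reprK.
by rewrite -quotmod_piD -!quotmod_piZ scalerDr quotmod_piD.
Qed.

Fact quotmod_scaleDl x : {morph quotmod_scale^~ x : a b / a + b}.
Proof.
move=> a b /=; rewrite -[x]quotmod_reprK.
by rewrite -!quotmod_piZ scalerDl quotmod_piD.
Qed.

HB.instance Definition _ := GRing.Zmodule_isLmodule.Build R quotmod
  quotmod_scaleA quotmod_scale1 quotmod_scaleDr quotmod_scaleDl.

Fact quotmod_pi_linear : linear quotmod_pi.
Proof. by move=> a x y; rewrite quotmod_piD quotmod_piZ. Qed.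

HB.instance Definition _ := GRing.isLinear.Build R V quotmod _ quotmod_pi
  quotmod_pi_linear.

End QuotientModule.

(* A / B for submodules B <= A of V; in general this is A / (A :&: B). *)
Definition subquot (R : pzRingType) (V : lmodType R) (A B : submodClosed V) :
    lmodType R :=
  quotmod (preimsm (submodule_val A) B).

Definition finitely_generated (R : pzRingType) (V : lmodType R)
    (F : submodClosed V) : Prop :=
  exists s : seq V, forall x : V,
    x \in F <-> exists c : 'I_(size s) -> R, x = \sum_(i < size s) c i *: s`_i.

Local Open Scope ereal_scope.

Record length_function (K : realType) (R : pzRingType)
    (L : lmodType R -> \bar K) : Prop := LengthFunction {
  length_ge0 : forall M : lmodType R, 0 <= L M;
  length_zero : forall M : lmodType R, (forall x : M, x = 0%R) -> L M = 0;
  length_iso : forall (M N : lmodType R) (f : {linear M -> N}),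
    bijective f -> L M = L N;
  length_exact : forall (A B C : lmodType R)
      (f : {linear A -> B}) (g : {linear B -> C}),
    injective f -> range g = setT -> range f = [set b | g b = 0%R] ->
    L B = L A + L C;
  length_sup : forall M : lmodType R,
    L M = ereal_sup
      [set L (submodule F) | F in [set F : submodClosed M | finitely_generated F]]
}.

(* v is a valuation on the field of fractions of R whose valuation ring is R
   and whose value group is a dense subgroup of the reals. *)
Record nondiscrete_archimedean_valuation (K : realType) (R : idomainType)
    (v : {fraction R} -> \bar K) : Prop := NondiscreteArchimedeanValuation {
  valuation_zero : v 0%R = +oo;
  valuation_fin_num : forall x, x != 0%R -> v x \is a fin_num;
  valuationM : forall x y, v (x * y)%R = v x + v y;
  valuationD : forall x y, mine (v x) (v y) <= v (x + y)%R;
  valuation_ring : forall x, 0 <= v x <-> exists r : R, x = tofrac r;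
  valuation_dense : dense [set g : K | exists x, v x = g%:E]
}.

Record valuation_length (K : realType) (R : idomainType)
    (v : {fraction R} -> \bar K) (L : lmodType R -> \bar K) : Prop :=
    ValuationLength {
  valuation_length_function : length_function L;
  valuation_length_cyclic : forall I : submodClosed R^o,
    L (quotmod I) = ereal_inf [set v (tofrac r) | r in [set r : R | r \in I]]
}.

Section IntrinsicEntropy.
Variables (K : realType) (R : idomainType) (L : lmodType R -> \bar K).
Variables (M : lmodType R) (phi : {linear M -> M}).

(* T_n(phi, H) = H + phi H + ... + phi^(n-1) H *)
Fixpoint trajectory (H : submodClosed M) (n : nat) : submodClosed M :=
  if n is m.+1 then addsm (trajectory H m) (iter m (imsm phi) H)
  else zerosm M.

Definition inert (H : submodClosed M) : Prop :=
  L (subquot (addsm H (imsm phi H)) H) < +oo.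

Definition entropy_at (H : submodClosed M) : \bar K :=
  limn (fun n => L (subquot (trajectory H n) H) * (n%:R^-1)%:E).

Definition entropy : \bar K :=
  ereal_sup [set entropy_at H | H in [set H : submodClosed M | inert H]].

End IntrinsicEntropy.

(* Main.v *)
Require Import Defs.
From HB Require Import structures.
From mathcomp Require Import all_boot all_order all_algebra.
From mathcomp Require Import all_classical all_reals all_analysis.

Set Implicit Arguments.
Unset Strict Implicit.
Unset Printing Implicit Defensive.

Import Order.TTheory GRing.Theory Num.Theory.
Import numFieldNormedType.Exports.

Local Open Scope classical_set_scope.
Local Open Scope ring_scope.

(** Write T_n for the trajectory T_n(phi, H) of an inert submodule H, and let

      U = { x | phi^n x lies in T_(n+1) for some n },

    an increasing union of submodules, because phi maps T_n into T_(n+1).  It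
    is the least submodule that contains H and its own preimage under phi.
    The point of the proof is that the limit defining the entropy at H is
    already a length attached to U:

      entropy_at H = L (U / phi^-1 U)           ([entropy_at_backward_hull]).

    All the successive quotients T_(n+2) / T_(n+1) are quotients of the single
    module (H + phi H) / H, through phi^n; this module has finite length since
    H is inert, and the class of x dies in the n-th quotient exactly when
    phi^n x lies in T_(n+1).  Hence the kernels increase to the kernel of
    (H + phi H) / H -> (U + phi U) / U, which is again surjective because
    U + phi U = U + phi H.  A length function is continuous along increasing
    unions, so on a module of finite length it is continuous along the
    corresponding quotients ([length_cvg_quotients]): the lengths of
    T_(n+2) / T_(n+1) tend to that of (U + phi U) / U ([length_step_cvg]).  The
    latter module is isomorphic to U / phi^-1 U through phi
    ([length_step_preim]).  Finally L (T_n / H) is the sum of the lengths of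
    the successive quotients, so dividing it by n and letting n grow gives the
    same limit, by Cesaro's lemma ([limn_average]).

    The two suprema are then taken over the same set of values.  The hull U of
    an inert H is inert and contains phi^-1 U, so the entropy at H is one of
    the lengths on the right.  Conversely, if N is inert and contains
    phi^-1 N, then N is its own hull, and L (N / phi^-1 N) is the entropy
    at N. *)

(** * Submodules and subquotients *)

Section FullSubmodule.
Variables (R : pzRingType) (V : lmodType R).

Definition fullsm_pred : {pred V} := predT.

Fact fullsm_closed : submod_closed fullsm_pred.
Proof. by []. Qed.

HB.instance Definition _ := GRing.isSubmodClosed.Build R V fullsm_pred
  fullsm_closed.

Definition fullsm : submodClosed V := fullsm_pred.

End FullSubmodule.

Arguments fullsm {R} V.

Section Submodules.
Variables (R : pzRingType) (V W : lmodType R).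

Lemma mem_zerosm (x : V) : (x \in zerosm V) = (x == 0).
Proof. by []. Qed.

Lemma mem_preimsm (f : {linear V -> W}) (A : submodClosed W) (x : V) :
  (x \in preimsm f A) = (f x \in A).
Proof. by []. Qed.

Lemma mem_addsm (A B : submodClosed V) (x : V) :
  x \in addsm A B <-> exists a b, [/\ a \in A, b \in B & x = a + b].
Proof. by split=> [/asboolP|?]; [|apply/asboolP]. Qed.

Lemma mem_addsml (A B : submodClosed V) (x : V) : x \in A -> x \in addsm A B.
Proof. by move=> xA; apply/mem_addsm; exists x, 0; rewrite addr0 rpred0. Qed.

Lemma mem_addsmr (A B : submodClosed V) (x : V) : x \in B -> x \in addsm A B.
Proof. by move=> xB; apply/mem_addsm; exists 0, x; rewrite add0r rpred0. Qed.

Lemma mem_imsm (f : {linear V -> W}) (A : submodClosed V) (y : W) :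
  y \in imsm f A <-> exists2 x, x \in A & y = f x.
Proof. by split=> [/asboolP|?]; [|apply/asboolP]. Qed.

Lemma submod_subr (A : submodClosed V) (x y : V) :
  x \in A -> y \in A -> x - y \in A.
Proof. by move=> xA yA; rewrite -scaleN1r rpredD ?rpredZ. Qed.

Lemma submod_addrK (A : submodClosed V) (x y : V) :
  y \in A -> x + y \in A -> x \in A.
Proof. by move=> yA xyA; rewrite -[x](addrK y) submod_subr. Qed.

End Submodules.

Section Corestriction.
Variables (R : pzRingType) (V W : lmodType R) (f : {linear V -> W}).
Variables (A : submodClosed W) (fA : forall x, f x \in A).

Definition corestrict_fun (x : V) : submodule A := Sub (f x) (fA x).

Fact corestrict_linear : linear corestrict_fun.
Proof. by move=> c x y; apply: val_inj; rewrite SubK linearP. Qed.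

HB.instance Definition _ := GRing.isLinear.Build R _ _ _ corestrict_fun
  corestrict_linear.

Definition corestrict : {linear V -> submodule A} := corestrict_fun.

Lemma corestrict_inj : injective f -> injective corestrict.
Proof. by move=> finj x y /(congr1 val); exact: finj. Qed.

End Corestriction.

Section Subquotients.
Variable R : pzRingType.

Definition subquot_pi (V : lmodType R) (A B : submodClosed V) :
    {linear submodule A -> subquot A B} :=
  @quotmod_pi R (submodule A) (preimsm (submodule_val A) B).

Lemma subquot_pi_eq (V : lmodType R) (A B : submodClosed V)
    (a b : submodule A) :
  subquot_pi A B a = subquot_pi A B b <-> val a - val b \in B.
Proof. exact: quotmod_piE. Qed.

Lemma subquot_pi_eq0 (V : lmodType R) (A B : submodClosed V) (a : submodule A) :
  subquot_pi A B a = 0 <-> val a \in B.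
Proof.
rewrite -(linear0 (subquot_pi A B)) subquot_pi_eq.
by rewrite -(raddfB (submodule_val A)) subr0.
Qed.

Lemma subquot_pi_surj (V : lmodType R) (A B : submodClosed V)
    (q : subquot A B) :
  exists a, q = subquot_pi A B a.
Proof. by exists (quotmod_repr q); rewrite [RHS]quotmod_reprK. Qed.

Section Map.
Variables (V V' : lmodType R) (f : {linear V -> V'}).
Variables (A B : submodClosed V) (A' B' : submodClosed V').
Hypothesis fA : forall x, x \in A -> f x \in A'.
Hypothesis fB : forall x, x \in A -> x \in B -> f x \in B'.

(** Induced by f on representatives: the representative of a class is only
    known up to an element of B, which [fB] absorbs. *)
Definition subquot_fun (q : subquot A B) : subquot A' B' :=
  let a : submodule A := quotmod_repr q in
  subquot_pi A' B' (Sub (f (val a)) (fA (valP a))).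

Lemma subquot_fun_pi (a : submodule A) (a' : submodule A') :
  val a' = f (val a) -> subquot_fun (subquot_pi A B a) = subquot_pi A' B' a'.
Proof.
move=> a'E; apply/subquot_pi_eq; rewrite SubK a'E -raddfB.
have rB : val (quotmod_repr (subquot_pi A B a)) - val a \in B.
  by apply/subquot_pi_eq; rewrite [LHS]quotmod_reprK.
by apply: fB rB; apply: submod_subr; exact: valP.
Qed.

Fact subquot_fun_linear : linear subquot_fun.
Proof.
move=> c q r; have [a ->] := subquot_pi_surj q.
have [b ->] := subquot_pi_surj r.
pose F (x : submodule A) : submodule A' := Sub (f (val x)) (fA (valP x)).
rewrite (@subquot_fun_pi a (F a)) ?SubK // (@subquot_fun_pi b (F b)) ?SubK //.
rewrite -!linearP; apply: subquot_fun_pi.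
by rewrite -[LHS]/(submodule_val A' _) !(linearP (submodule_val _)) linearP.
Qed.

HB.instance Definition _ := GRing.isLinear.Build R _ _ _ subquot_fun
  subquot_fun_linear.

Definition subquot_map : {linear subquot A B -> subquot A' B'} := subquot_fun.

Lemma subquot_map_pi (a : submodule A) (a' : submodule A') :
  val a' = f (val a) -> subquot_map (subquot_pi A B a) = subquot_pi A' B' a'.
Proof. exact: subquot_fun_pi. Qed.

Lemma subquot_map_eq0 (a : submodule A) :
  subquot_map (subquot_pi A B a) = 0 <-> f (val a) \in B'.
Proof.
rewrite (@subquot_map_pi _ (Sub (f (val a)) (fA (valP a)))) ?SubK //.
by rewrite subquot_pi_eq0 SubK.
Qed.

Lemma subquot_map_inj :
  (forall x, x \in A -> f x \in B' -> x \in B) -> injective subquot_map.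
Proof.
move=> fBinv; apply: raddf_inj => q; have [a ->] := subquot_pi_surj q.
by move=> /subquot_map_eq0/fBinv aB; apply/subquot_pi_eq0/aB/valP.
Qed.

Lemma subquot_map_surj :
  (forall y, y \in A' -> exists2 x, x \in A & y - f x \in B') ->
  forall r, exists q, subquot_map q = r.
Proof.
move=> fsurj r; have [y ->] := subquot_pi_surj r.
have [x xA yx] := fsurj _ (valP y).
exists (subquot_pi A B (Sub x xA)).
rewrite (@subquot_map_pi _ (Sub (f x) (fA xA))) ?SubK //.
by apply/esym/subquot_pi_eq; rewrite SubK.
Qed.

End Map.

End Subquotients.
(** * Length functions *)

Section LengthFunctions.
Variables (K : realType) (R : pzRingType) (L : lmodType R -> \bar K).
Hypothesis hL : length_function L.

Let quotmod_pi_eq0 (V : lmodType R) (A : submodClosed V) (x : V) :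
  quotmod_pi A x = 0 <-> x \in A.
Proof. by rewrite -(linear0 (quotmod_pi A)) quotmod_piE subr0. Qed.

(** The complement to the length of V in that of W is the length of the
    cokernel of f. *)
Lemma length_inj_le (V W : lmodType R) (f : {linear V -> W}) :
  injective f -> (L V <= L W)%E.
Proof.
move=> finj; pose I := imsm f (fullsm V).
rewrite (length_exact hL (f := f) (g := quotmod_pi I)) //.
- by rewrite leeDl // (length_ge0 hL).
- apply/seteqP; split=> // q _.
  by exists (quotmod_repr q) => //; exact: quotmod_reprK.
- apply/seteqP; split=> y /=.
    by case=> x _ <-; apply/quotmod_pi_eq0/mem_imsm; exists x.
  by move/quotmod_pi_eq0/mem_imsm=> [x _ ->]; exists x.
Qed.

Lemma length_ker_surj (V W : lmodType R) (g : {linear V -> W}) :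
  (forall y, exists x, g x = y) ->
  L V = (L (submodule (preimsm g (zerosm W))) + L W)%E.
Proof.
move=> gsurj.
apply: (length_exact hL (f := submodule_val (preimsm g (zerosm W))) (g := g)).
- exact: val_inj.
- by apply/seteqP; split=> // y _; have [x <-] := gsurj y; exists x.
- apply/seteqP; split=> x /=.
    by case=> -[y /= yK] _ <-; apply/eqP.
  by move/eqP => xK; exists (Sub x xK).
Qed.

Lemma length_subquot_iso (V V' : lmodType R) (f : {linear V -> V'})
    (A B : submodClosed V) (A' B' : submodClosed V') :
  (forall x, x \in A -> f x \in A') ->
  (forall x, x \in A -> (f x \in B') = (x \in B)) ->
  (forall y, y \in A' -> exists2 x, x \in A & y - f x \in B') ->
  L (subquot A B) = L (subquot A' B').
Proof.
move=> fA fB fsurj.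
have fB' x : x \in A -> x \in B -> f x \in B' by move=> xA; rewrite fB.
have sigma := subquot_map_surj fA fB' fsurj.
have inj : injective (subquot_map fA fB').
  by apply: subquot_map_inj => // x xA; rewrite fB.
apply: (length_iso hL (f := subquot_map fA fB')).
pose h r := projT1 (cid (sigma r)).
have hK : cancel h (subquot_map fA fB').
  by move=> r; exact: projT2 (cid (sigma r)).
by exists h => // q; apply: inj; rewrite hK.
Qed.

Lemma length_subquot_add (V : lmodType R) (A B C : submodClosed V) :
  {subset A <= B} -> {subset B <= C} ->
  L (subquot C A) = (L (subquot B A) + L (subquot C B))%E.
Proof.
move=> AB BC.
have fB x : x \in C -> x \in A -> (idfun x : V) \in B by move=> _ /AB.
have fA x : x \in B -> (idfun x : V) \in C by move/BC.
have fC x : x \in C -> (idfun x : V) \in C by [].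
have fAA x : x \in B -> x \in A -> (idfun x : V) \in A by [].
apply: (length_exact hL (f := subquot_map fA fAA) (g := subquot_map fC fB)).
- exact: subquot_map_inj.
- apply/seteqP; split=> // r _.
  have [|q qr] := subquot_map_surj fC fB _ r; last by exists q.
  by move=> y yC; exists y => //; rewrite subrr rpred0.
- apply/seteqP; split=> q /=.
    case=> p _ <-; have [b ->] := subquot_pi_surj p.
    have fb := fA _ (valP b).
    rewrite (subquot_map_pi fA fAA (a := b) (a' := Sub (val b) fb)) ?SubK //.
    exact/(subquot_map_eq0 fC fB)/(valP b).
  have [c ->] := subquot_pi_surj q => /(subquot_map_eq0 fC fB) cB.
  exists (subquot_pi B A (Sub (val c) cB)) => //.
  exact: subquot_map_pi.
Qed.

(** Upper continuity.  A finitely generated submodule of C has its generators,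
    and therefore all its elements, in a single term of the chain; as the
    length of C is the supremum over such submodules, the terms of the chain
    reach it. *)
Lemma length_bigcup (V : lmodType R) (B : nat -> submodClosed V)
    (C : submodClosed V) :
  (forall n, {subset B n <= B n.+1}) ->
  (forall x, x \in C <-> exists n, x \in B n) ->
  L (submodule (B n)) @[n --> \oo] --> L (submodule C).
Proof.
move=> Bmono CE.
have Ble m n : (m <= n)%N -> {subset B m <= B n}.
  move=> /subnK <-; elim: (n - m)%N => // k IHk x /IHk; exact: Bmono.
have incl (A D : submodClosed V) : {subset A <= D} ->
    (L (submodule A) <= L (submodule D))%E.
  move=> AD; have AD' (x : submodule A) : submodule_val A x \in D.
    exact/AD/valP.
  apply: (length_inj_le (f := corestrict AD')).
  exact/corestrict_inj/val_inj.
have -> : L (submodule C) = ereal_sup (range (fun n => L (submodule (B n)))).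
  apply/eqP; rewrite eq_le; apply/andP; split; last first.
    apply: ge_ereal_sup => _ [n _ <-]; apply: incl => x xB.
    by apply/CE; exists n.
  rewrite (length_sup hL (submodule C)); apply: ge_ereal_sup => _ [F [s Fs] <-].
  have [n sB] : exists n, forall x, x \in s -> val x \in B n.
    elim: s {Fs} => [|x s [n sB]]; first by exists 0%N.
    have [m xB] : exists m, val x \in B m by apply/CE/valP.
    exists (maxn m n) => y; rewrite inE => /predU1P[->|/sB].
      by apply: Ble xB; exact: leq_maxl.
    by apply: Ble; exact: leq_maxr.
  have FB (x : submodule F) :
      (submodule_val C \o submodule_val F) x \in B n.
    have /Fs[c xE] := valP x; rewrite -[X in X \in _]/(submodule_val C (val x)).
    rewrite xE raddf_sum rpred_sum // => i _.
    rewrite -[X in X \in _]/(submodule_val C (c i *: s`_i)) linearZ rpredZ //.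
    by apply: sB; rewrite mem_nth.
  apply: (@le_trans _ _ (L (submodule (B n)))); last first.
    by apply: ereal_sup_ubound; exists n.
  apply: (length_inj_le (f := corestrict FB)); apply: corestrict_inj.
  exact: inj_comp val_inj val_inj.
apply: ereal_nondecreasing_cvgn => m n mn; exact/incl/Ble.
Qed.

(** The length of a quotient of V is that of V minus that of the kernel, and
    the kernels converge by [length_bigcup].  The subtraction is where the
    finiteness of the length of V is essential: for V an infinite direct sum of
    copies of a module of length one, and W n the quotient by the first n
    summands, the lengths of the W n are infinite although the limit is 0. *)
Lemma length_cvg_quotients (V : lmodType R) (W : nat -> lmodType R)
    (W' : lmodType R) (g : forall n, {linear V -> W n})
    (g' : {linear V -> W'}) :
  (L V < +oo)%E ->
  (forall n y, exists x, g n x = y) -> (forall y, exists x, g' x = y) ->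
  (forall n x, g n x = 0 -> g n.+1 x = 0) ->
  (forall x, g' x = 0 <-> exists n, g n x = 0) ->
  L (W n) @[n --> \oo] --> L W'.
Proof.
move=> VltP gsurj gsurj' gmono gker.
have fin (X : lmodType R) : (L X <= L V)%E -> L X \is a fin_num.
  by move=> XV; rewrite ge0_fin_numE ?(length_ge0 hL) // (le_lt_trans XV).
have kerle (X : lmodType R) (h : {linear V -> X}) :
    L (submodule (preimsm h (zerosm X))) \is a fin_num.
  apply/fin/(length_inj_le (f := submodule_val _)); exact: val_inj.
have quotE (X : lmodType R) (h : {linear V -> X}) :
    (forall y, exists x, h x = y) ->
    L X = (L V - L (submodule (preimsm h (zerosm X))))%E.
  by move=> hsurj; rewrite (length_ker_surj hsurj) addeAC subee ?kerle ?add0e.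
rewrite (quotE _ _ gsurj') (_ : (fun n => L (W n)) =
  (cst (L V) \- (fun n => L (submodule (preimsm (g n) (zerosm _)))))%E).
  apply: cvgeB; first exact/fin_num_adde_defr/fin.
    exact: cvg_cst.
  apply: length_bigcup => [n x|x]; rewrite mem_preimsm mem_zerosm.
    by move/eqP/gmono/eqP.
  split=> [/eqP/gker[n gx]|[n /eqP gx]]; first by exists n; apply/eqP.
  by apply/eqP/gker; exists n.
by apply/funext => n; exact: quotE.
Qed.

End LengthFunctions.
(** * Averages *)

(** Cesaro's lemma for a sequence given by its increments.  The increments are
    summed from the index 1 on: the increment of the sequence n |-> L (T_n / H)
    at the index 0 is not of the same kind, since T_0 does not contain H. *)
Lemma limn_average (K : realType) (f d : (\bar K)^nat) (l : \bar K) :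
  f 1%N = 0%E -> (forall n, f n.+2 = f n.+1 + d n)%E ->
  (forall n, d n \is a fin_num) -> l \is a fin_num ->
  d n @[n --> \oo] --> l ->
  limn (fun n => f n * (n%:R^-1)%:E)%E = l.
Proof.
move=> f1 fS dfin lfin dl.
(* The leading 0 makes the partial sums of u of length n.+1 equal to f n.+1. *)
pose u n := if n is m.+1 then fine (d m) else 0.
have fE n : f n.+1 = (series u n.+1)%:E.
  elim: n => [|n IHn]; first by rewrite /series /= big_nat1.
  rewrite fS IHn [in RHS]seriesEord /= big_ord_recr /= EFinD fineK //.
  by rewrite seriesEord.
have ul : u @ \oo --> fine l.
  by rewrite -cvg_shiftS; apply: fine_cvg; rewrite fineK.
apply/cvg_lim => //; rewrite -(fineK lfin).
rewrite -(cvg_shiftS (fun n => f n * (n%:R^-1)%:E)%E).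
rewrite (_ : [sequence _]_n = EFin \o arithmetic_mean u).
  by apply: cvg_comp (cesaro ul) _; exact: cvg_id.
by apply/funext => n; rewrite /= fE -EFinM mulrC.
Qed.

(** * Trajectories and the backward hull *)

Section Trajectories.
Variables (R : idomainType) (M : lmodType R) (phi : {linear M -> M}).

Fact iter_linear n : linear (iter n phi).
Proof. by elim: n => [|n IHn] c x y //=; rewrite IHn linearP. Qed.

HB.instance Definition _ n := GRing.isLinear.Build R _ _ _ (iter n phi)
  (iter_linear n).

Lemma iter_linearD n x y : iter n phi (x + y) = iter n phi x + iter n phi y.
Proof. exact: linearD. Qed.

Lemma iter_linearB n x y : iter n phi (x - y) = iter n phi x - iter n phi y.
Proof. exact: linearB. Qed.

Variable H : submodClosed M.

Lemma mem_iter_imsm n x :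
  x \in iter n (imsm phi) H <-> exists2 h, h \in H & x = iter n phi h.
Proof.
elim: n x => [|n IHn] x /=.
  by split=> [xH|[h hH ->]] //; exists x.
split=> [/mem_imsm[y /IHn[h hH ->] ->]|[h hH ->]]; first by exists h.
by apply/mem_imsm; exists (iter n phi h) => //; apply/IHn; exists h.
Qed.

Lemma mem_trajectoryS n x : x \in trajectory phi H n.+1 <->
  exists t h, [/\ t \in trajectory phi H n, h \in H & x = t + iter n phi h].
Proof.
split=> [/mem_addsm[t [_ [tT /mem_iter_imsm[h hH ->] ->]]]|[t [h [tT hH ->]]]].
  by exists t, h.
apply/mem_addsm; exists t, (iter n phi h); split=> //.
by apply/mem_iter_imsm; exists h.
Qed.

Lemma trajectory_mono n : {subset trajectory phi H n <= trajectory phi H n.+1}.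
Proof. by move=> x; exact: mem_addsml. Qed.

Lemma trajectory1 : trajectory phi H 1 =i H.
Proof.
move=> x; apply/idP/idP => [/mem_trajectoryS[t [h [tT hH ->]]]|xH].
  by move: tT; rewrite mem_zerosm => /eqP->; rewrite add0r.
by apply/mem_trajectoryS; exists 0, x; rewrite add0r rpred0.
Qed.

Lemma sub_trajectory n : {subset H <= trajectory phi H n.+1}.
Proof.
elim: n => [|n IHn] x xH; first by rewrite trajectory1.
exact/trajectory_mono/IHn.
Qed.

Lemma iter_trajectory n h : h \in H -> iter n phi h \in trajectory phi H n.+1.
Proof. by move=> hH; apply/mem_addsmr/mem_iter_imsm; exists h. Qed.

Lemma trajectory_image n x :
  x \in trajectory phi H n -> phi x \in trajectory phi H n.+1.
Proof.
elim: n x => [|n IHn] x.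
  by rewrite mem_zerosm => /eqP->; rewrite linear0 rpred0.
move/mem_trajectoryS => [t [h [tT hH ->]]]; rewrite linearD rpredD //.
  exact/trajectory_mono/IHn.
exact: (iter_trajectory n.+1).
Qed.

Lemma iter_trajectory_le m n x : (m <= n)%N ->
  iter m phi x \in trajectory phi H m.+1 ->
  iter n phi x \in trajectory phi H n.+1.
Proof.
by move=> /subnK <- mT; elim: (n - m)%N => // k IHk; exact: trajectory_image.
Qed.

(** The union of the increasing chain H, H + phi^-1 H, H + phi^-1 (H + phi^-1 H)
    and so on: the n-th term of this chain is the preimage of T_(n+1) under
    phi^n, and this description makes the kernels in the limit-free formula
    visible at once. *)
Definition backward_hull_pred : {pred M} :=
  [pred x | `[< exists n, iter n phi x \in trajectory phi H n.+1 >]].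

Lemma mem_backward_hull x : x \in backward_hull_pred <->
  exists n, iter n phi x \in trajectory phi H n.+1.
Proof. by split=> [/asboolP|?]; [|apply/asboolP]. Qed.

Fact backward_hull_closed : submod_closed backward_hull_pred.
Proof.
split=> [|c x y].
  by apply/mem_backward_hull; exists 0%N; rewrite rpred0.
move=> /mem_backward_hull[m xm] /mem_backward_hull[n yn].
apply/mem_backward_hull; exists (maxn m n); rewrite linearP rpredD ?rpredZ //.
  exact: iter_trajectory_le (leq_maxl m n) xm.
exact: iter_trajectory_le (leq_maxr m n) yn.
Qed.

HB.instance Definition _ := GRing.isSubmodClosed.Build R M backward_hull_pred
  backward_hull_closed.

Definition backward_hull : submodClosed M := backward_hull_pred.

Lemma sub_backward_hull : {subset H <= backward_hull}.
Proof.
by move=> x xH; apply/mem_backward_hull; exists 0%N; rewrite trajectory1.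
Qed.

Lemma backward_hull_preim : {subset preimsm phi backward_hull <= backward_hull}.
Proof.
move=> x; rewrite mem_preimsm => /mem_backward_hull[n xn].
apply/mem_backward_hull; exists n.+1; rewrite iterSr.
exact: trajectory_mono.
Qed.

(** The half of the fixed-point equation U = H + phi^-1 U that yields
    phi U <= phi H + U: if n > 0 and phi^n u = t + phi^n h with t in T_n, then
    phi^n sends u - h to t, so that phi^(n-1) sends phi (u - h) into T_n. *)
Lemma backward_hull_decomp u : u \in backward_hull ->
  exists2 h, h \in H & phi (u - h) \in backward_hull.
Proof.
move=> /mem_backward_hull[[|n]]; first rewrite trajectory1 => uH.
  by exists u; rewrite // subrr linear0 rpred0.
move=> /mem_trajectoryS[t [h [tT hH uE]]]; exists h => //.
apply/mem_backward_hull; exists n.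
by rewrite -iterSr iter_linearB uE addrK.
Qed.

(** Peeling off the last summand phi^n h of an element of T_(n+1) replaces x by
    x - h and lowers n by one. *)
Lemma backward_hull_min (N : submodClosed M) :
  {subset H <= N} -> {subset preimsm phi N <= N} -> {subset backward_hull <= N}.
Proof.
move=> HN pN x /mem_backward_hull[n]; elim: n x => [|n IHn] x.
  by rewrite trajectory1; exact: HN.
move=> /mem_trajectoryS[t [h [tT hH xE]]].
apply: (submod_addrK (y := - h)); first by rewrite -scaleN1r rpredZ ?HN.
by apply/pN/IHn; rewrite -iterSr iter_linearB xE addrK.
Qed.

End Trajectories.

(** * The limit-free formula *)

Section LimitFree.
Variables (K : realType) (R : idomainType) (L : lmodType R -> \bar K).
Hypothesis hL : length_function L.
Variables (M : lmodType R) (phi : {linear M -> M}).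

(** phi induces a map from N onto (N + phi N) / N whose kernel is the
    intersection of N with phi^-1 N, that is phi^-1 N. *)
Lemma length_step_preim (N : submodClosed M) : {subset preimsm phi N <= N} ->
  L (subquot N (preimsm phi N)) = L (subquot (addsm N (imsm phi N)) N).
Proof.
move=> pN; apply: (length_subquot_iso hL (f := phi)) => [x xN|//|y].
  by apply/mem_addsmr/mem_imsm; exists x.
move=> /mem_addsm[a [_ [aN /mem_imsm[x xN ->] ->]]].
by exists x => //; rewrite addrK.
Qed.

Section Hull.
Variable H : submodClosed M.
Hypothesis Hinert : inert L phi H.

Local Notation T := (trajectory phi H).
Local Notation U := (backward_hull phi H).
Local Notation HpH := (addsm H (imsm phi H)).
Local Notation UpU := (addsm U (imsm phi U)).

Let step_in n x : x \in HpH -> iter n phi x \in T n.+2.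
Proof.
move=> /mem_addsm[a [_ [aH /mem_imsm[b bH ->] ->]]].
rewrite iter_linearD -iterSr.
rewrite rpredD //; last exact: iter_trajectory.
exact/trajectory_mono/iter_trajectory.
Qed.

Let step_zero n x : x \in HpH -> x \in H -> iter n phi x \in T n.+1.
Proof. by move=> _; exact: iter_trajectory. Qed.

Let step n : {linear subquot HpH H -> subquot (T n.+2) (T n.+1)} :=
  subquot_map (@step_in n) (@step_zero n).

Let step_surj n y : exists x, step n x = y.
Proof.
apply: subquot_map_surj => z /mem_trajectoryS[t [h [tT hH ->]]].
exists (phi h); first by apply/mem_addsmr/mem_imsm; exists h.
by rewrite iterSr addrK.
Qed.

Let hull_in x : x \in HpH -> (idfun x : M) \in UpU.
Proof.
move=> /mem_addsm[a [_ [aH /mem_imsm[b bH ->] ->]]]; apply/mem_addsm.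
exists a, (phi b); split=> //; first exact: sub_backward_hull.
by apply/mem_imsm; exists b => //; exact: sub_backward_hull.
Qed.

Let hull_zero x : x \in HpH -> x \in H -> (idfun x : M) \in U.
Proof. by move=> _; exact: sub_backward_hull. Qed.

Let to_hull : {linear subquot HpH H -> subquot UpU U} :=
  subquot_map hull_in hull_zero.

Let to_hull_surj y : exists x, to_hull x = y.
Proof.
apply: subquot_map_surj => z /mem_addsm[a [_ [aU /mem_imsm[u uU ->] ->]]].
have [h hH uhU] := backward_hull_decomp uU.
exists (phi h); first by apply/mem_addsmr/mem_imsm; exists h.
by rewrite -addrA -linearB rpredD.
Qed.

Let step_eq0 n a :
  step n (subquot_pi HpH H a) = 0 <-> iter n phi (val a) \in T n.+1.
Proof. exact: subquot_map_eq0. Qed.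

(** Applies [length_cvg_quotients] to the maps induced by phi^n and by the
    identity on (H + phi H) / H. *)
Lemma length_step_cvg :
  L (subquot (T n.+2) (T n.+1)) @[n --> \oo] --> L (subquot UpU U).
Proof.
apply: (length_cvg_quotients hL (g := step) (g' := to_hull)) => //.
- move=> n q; have [a ->] := subquot_pi_surj q.
  by move=> /step_eq0 an; apply/step_eq0; apply: iter_trajectory_le an.
- move=> q; have [a ->] := subquot_pi_surj q; split.
    move=> /(subquot_map_eq0 hull_in hull_zero)/mem_backward_hull[n an].
    by exists n; apply/step_eq0.
  move=> [n /step_eq0 an]; apply/(subquot_map_eq0 hull_in hull_zero).
  by apply/mem_backward_hull; exists n.
Qed.

Let quotient_fin (W : lmodType R) (g : {linear subquot HpH H -> W}) :
  (forall y, exists x, g x = y) -> L W \is a fin_num.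
Proof.
move=> gsurj; rewrite ge0_fin_numE ?(length_ge0 hL) //.
apply: le_lt_trans Hinert; rewrite [leRHS](length_ker_surj hL gsurj).
by rewrite leeDr // (length_ge0 hL).
Qed.

Lemma backward_hull_inert : inert L phi U.
Proof.
have := quotient_fin to_hull_surj.
by rewrite ge0_fin_numE ?(length_ge0 hL).
Qed.

Lemma entropy_at_backward_hull :
  entropy_at L phi H = L (subquot U (preimsm phi U)).
Proof.
rewrite length_step_preim; last exact: backward_hull_preim.
apply: limn_average length_step_cvg.
- apply: (length_zero hL) => q; have [a ->] := subquot_pi_surj q.
  by apply/subquot_pi_eq0; rewrite -(trajectory1 phi H); exact: valP.
- move=> n; apply: (length_subquot_add hL); first exact: sub_trajectory.
  exact: trajectory_mono.
- by move=> n; exact: quotient_fin (@step_surj n).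
- exact: quotient_fin to_hull_surj.
Qed.

End Hull.

(** Such an N is its own backward hull. *)
Lemma entropy_at_preim_closed (N : submodClosed M) :
  inert L phi N -> {subset preimsm phi N <= N} ->
  entropy_at L phi N = L (subquot N (preimsm phi N)).
Proof.
move=> Ninert pN; rewrite entropy_at_backward_hull //.
have UN : backward_hull phi N =i N.
  move=> x; apply/idP/idP; last exact: sub_backward_hull.
  exact: backward_hull_min.
apply: (length_subquot_iso hL (f := idfun)) => [x|x _|y yN].
- by rewrite UN.
- by rewrite !mem_preimsm UN.
- by exists y; rewrite ?UN // subrr rpred0.
Qed.

Lemma entropy_limit_free :
  entropy L phi =
  ereal_sup [set L (subquot N (preimsm phi N)) |
    N in [set N : submodClosed M |
           inert L phi N /\ {subset preimsm phi N <= N}]].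
Proof.
rewrite /entropy; congr ereal_sup; apply/seteqP; split.
  move=> _ [H Hinert <-]; exists (backward_hull phi H).
    by split; [exact: backward_hull_inert|exact: backward_hull_preim].
  by rewrite entropy_at_backward_hull.
move=> _ [N [Ninert pN] <-]; exists N => //.
exact: entropy_at_preim_closed.
Qed.

End LimitFree.

Theorem proposition3p4 (K : realType) (R : idomainType)
    (v : {fraction R} -> \bar K)
    (hv : nondiscrete_archimedean_valuation v)
    (Lv : lmodType R -> \bar K)
    (hLv : valuation_length v Lv)
    (M : lmodType R) (phi : {linear M -> M}) :
  entropy Lv phi =
  ereal_sup [set Lv (subquot N (preimsm phi N)) |
    N in [set N : submodClosed M |
           inert Lv phi N /\ {subset preimsm phi N <= N}]].
Proof. exact: entropy_limit_free (valuation_length_function hLv) M phi. Qed.
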